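(* $\bigl(C(\{0,1\}^{\mathbb{N}}), I, \gamma\bigr)$ is the initial object of $\mathscr{A}^\infty$; that is, for each object $(V, v, \delta)$ of $\mathscr{A}^\infty$ there is exactly one map $\bigl(C(\{0,1\}^{\mathbb{N}}), I, \gamma\bigr) \to (V, v, \delta)$ in $\mathscr{A}^\infty$.
   Context: $\mathbb{F}$ is a fixed field, either $\mathbb{R}$ or $\mathbb{C}$. For Banach spaces $V, W$ over $\mathbb{F}$, $V \oplus_\infty W$ is the direct sum with norm $\|(v,w)\| = \max\{\|v\|, \|w\|\}$. $\mathscr{A}^\infty$ is the category whose objects are triples $(V, v, \delta)$ where $V$ is a Banach space, $v \in V$ with $\|v\| \le 1$, and $\delta \colon V \oplus_\infty V \to V$ is a linear contraction (linear map of norm $\le 1$) satisfying $\delta(v,v) = v$. A map $(V', v', \delta') \to (V, v, \delta)$ is a linear contraction $\theta \colon V' \to V$ such that $\theta(v') = v$ and $\theta(\delta'(v'_1, v'_2)) = \delta(\theta(v'_1), \theta(v'_2))$ for all $v'_1, v'_2 \in V'$. $\{0,1\}^{\mathbb{N}}$ (Cantor space, sequences $(x_0, x_1, \ldots)$ of bits) has the product topology, and $C(\{0,1\}^{\mathbb{N}})$ is the Banach space of continuous functions $\{0,1\}^{\mathbb{N}} \to \mathbb{F}$ with the sup norm. $I$ is the constant function $1$. The map $\gamma \colon C(\{0,1\}^{\mathbb{N}}) \oplus_\infty C(\{0,1\}^{\mathbb{N}}) \to C(\{0,1\}^{\mathbb{N}})$ is defined by $(\gamma(f,g))(x_0, x_1,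 \ldots) = f(x_1, x_2, \ldots)$ if $x_0 = 0$ and $= g(x_1, x_2, \ldots)$ if $x_0 = 1$. The triple $\bigl(C(\{0,1\}^{\mathbb{N}}), I, \gamma\bigr)$ is an object of $\mathscr{A}^\infty$. *)

(* Defs.v *)
From HB Require Import structures.
From mathcomp Require Import all_boot all_order all_algebra.
From mathcomp Require Import complex.
From mathcomp Require Import all_classical all_reals topology normedtype cantor.

Set Implicit Arguments.
Unset Strict Implicit.
Unset Printing Implicit Defensive.

Import Order.TTheory GRing.Theory Num.Theory.
Import numFieldNormedType.Exports.

Local Open Scope classical_set_scope.
Local Open Scope ring_scope.

Variant scalars := RealScalars | ComplexScalars.

Definition scalar_field (R : realType) (s : scalars) : numFieldType :=
  match s with RealScalars => R | ComplexScalars => R[i] end.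

Section ScalarField.
Variables (R : realType) (s : scalars).
Local Notation F := (scalar_field R s).

Lemma scalar_sup (A : set F) : A !=set0 -> (forall x, A x -> 0 <= x) ->
  has_ubound A -> supremums A !=set0.
Proof.
case: s A => /= A A0 Age0 [M AM].
  exists (sup A); split.
    by move=> x Ax; apply: sup_upper_bound => //; split=> //; exists M.
  by move=> y Ay; apply: ge_sup.
case: A0 => a Aa.
have Are x : A x -> x = (complex.Re x)%:C%C.
  by move=> /Age0 /ger0_real /RRe_real.
have AR x y : A x -> x <= y -> y = (complex.Re y)%:C%C.
  by move=> /Age0 x0 xy; rewrite RRe_real// ger0_real// (le_trans x0).
have Ble : has_sup (@complex.Re R @` A).
  split; first by exists (complex.Re a), a.
  exists (complex.Re M) => _ [x Ax <-].
  by have := AM _ Ax; rewrite lecE => /andP[].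
exists ((sup (@complex.Re R @` A))%:C%C); split.
  move=> x Ax; rewrite (Are _ Ax) lecR.
  by apply: sup_upper_bound => //; exists x.
move=> y Ay; rewrite (AR a y Aa (Ay _ Aa)) lecR.
apply: ge_sup; first by case: Ble.
by move=> _ [x Ax <-]; have := Ay _ Ax; rewrite lecE => /andP[].
Qed.

Lemma complex_complete (G : set_system (R[i] : numFieldType)) :
  ProperFilter G -> cauchy G -> cvg G.
Proof.
move=> GF /cauchyP Gc.
have lim1 (p : R[i] -> R) : (forall x y, `|p x - p y|%:C%C <= `|x - y|) ->
    exists a : R, forall e, 0 < e -> G [set z | `|a - p z| < e].
  move=> ple; suff /cvg_ex[a Ga] : cvg (p @ G).
    by exists a => e e0; move/cvgrPdist_lt : Ga => /(_ e e0).
  apply: R_complete; apply: cauchy_exP => e e0.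
  have e0' : 0 < e%:C%C by rewrite ltcR.
  have [x Gx] := Gc _ e0'; exists (p x).
  change (G (p @^-1` ball (p x) e)); apply: filterS Gx => y /= xy.
  rewrite /preimage/= /ball/= -ltcR; exact: le_lt_trans (ple _ _) xy.
have [a Ga] : exists a : R, forall e, 0 < e ->
    G [set z | `|a - complex.Re z| < e].
  by apply: lim1 => x y; rewrite -raddfB; exact: normc_ge_Re.
have [b Gb] : exists b : R, forall e, 0 < e ->
    G [set z | `|b - complex.Im z| < e].
  apply: lim1 => x y; rewrite -raddfB -[leRHS]mul1r -(@normCi R[i]) -normrM.
  by rewrite mulrC -normrN -[X in `|X|%:C%C]ReiNIm; exact: normc_ge_Re.
apply/cvg_ex; exists (a +i* b)%C; apply/cvgrPdist_lt => e e0.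
have eE : e = (complex.Re e)%:C%C by rewrite RRe_real// gtr0_real.
have e20 : 0 < complex.Re e / 2 by rewrite divr_gt0// -ltcR -eE.
change (G [set t : R[i] | `|(a +i* b)%C - t| < e]).
apply: filterS (filterI (Ga _ e20) (Gb _ e20)) => z /= [az bz].
rewrite eE [complex.Re e]splitr [_ - z]complexE.
apply: le_lt_trans (ler_normD _ _) _.
rewrite normrM normCi mul1r.
have nR (r : R) : `|r%:C%C| = `|r|%:C%C :> R[i].
  by rewrite normc_def/= expr0n addr0 sqrtr_sqr.
rewrite !nR -rmorphD ltcR; case: z az bz => x y /= ax bay.
exact: ltrD.
Qed.

Lemma scalar_complete (G : set_system F) :
  ProperFilter G -> cauchy G -> cvg G.
Proof.
case: s G; [exact: R_complete|exact: complex_complete].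
Qed.

End ScalarField.

Definition cantor_shift (x : cantor_space) : cantor_space := fun n => x n.+1.

Lemma cantor_coord_continuous n : continuous (fun x : cantor_space => x n).
Proof. exact: (@proj_continuous _ (fun _ : nat => bool) n). Qed.

Lemma cantor_shift_continuous : continuous cantor_shift.
Proof.
move=> x; apply/cvg_sup => n U [V [[W oW] <-] Wx VU].
apply: (filterS VU); apply: (@cantor_coord_continuous n.+1 x W).
exact: open_nbhs_nbhs.
Qed.

(* The space of continuous functions on Cantor space. A synonym is needed
   because the library attaches other topologies to [continuousType]. *)
Definition Ccantor (R : realType) (s : scalars) : Type :=
  continuousType cantor_space (scalar_field R s).

HB.instance Definition _ (R : realType) (s : scalars) :=
  Choice.on (Ccantor R s).

Section SupNorm.
Variables (R : realType) (s : scalars).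
Local Notation F := (scalar_field R s).
Implicit Types f g h : Ccantor R s.

Lemma Ccantor_continuous f : continuous f.
Proof. exact: cts_fun. Qed.

Definition mkCcantor (f : cantor_space -> F) (cf : continuous f) :
  Ccantor R s := (mkcts cf : continuousType cantor_space F).

Lemma CcantorP f g : f =1 g -> f = g.
Proof. by move=> fg; apply/continuousEP. Qed.

Lemma CcantorD_continuous f g : continuous (fun x => f x + g x).
Proof. by move=> x; apply: cvgD; exact: Ccantor_continuous. Qed.

Lemma CcantorZ_continuous (a : F) f : continuous (fun x => a * f x).
Proof. by move=> x; apply: cvgMr; exact: Ccantor_continuous. Qed.

Lemma CcantorN_continuous f : continuous (fun x => - f x).
Proof. by move=> x; apply: cvgN; exact: Ccantor_continuous. Qed.

Lemma Ccantor_cst_continuous (a : F) : continuous (fun _ : cantor_space => a).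
Proof. by move=> x; exact: cvg_cst. Qed.

Definition Ccantor_cst (a : F) := mkCcantor (@Ccantor_cst_continuous a).
Definition Ccantor_add f g := mkCcantor (@CcantorD_continuous f g).
Definition Ccantor_opp f := mkCcantor (@CcantorN_continuous f).
Definition Ccantor_scale (a : F) f := mkCcantor (@CcantorZ_continuous a f).

Lemma Ccantor_addA : associative Ccantor_add.
Proof. by move=> f g h; apply: CcantorP => x; exact: addrA. Qed.

Lemma Ccantor_addC : commutative Ccantor_add.
Proof. by move=> f g; apply: CcantorP => x; exact: addrC. Qed.

Lemma Ccantor_add0 : left_id (Ccantor_cst 0) Ccantor_add.
Proof. by move=> f; apply: CcantorP => x; exact: add0r. Qed.

Lemma Ccantor_addN : left_inverse (Ccantor_cst 0) Ccantor_opp Ccantor_add.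
Proof. by move=> f; apply: CcantorP => x; exact: addNr. Qed.

HB.instance Definition _ := GRing.isZmodule.Build (Ccantor R s)
  Ccantor_addA Ccantor_addC Ccantor_add0 Ccantor_addN.

Lemma Ccantor_scaleA a b f :
  Ccantor_scale a (Ccantor_scale b f) = Ccantor_scale (a * b) f.
Proof. by apply: CcantorP => x; exact: mulrA. Qed.

Lemma Ccantor_scale1 : left_id 1 Ccantor_scale.
Proof. by move=> f; apply: CcantorP => x; exact: mul1r. Qed.

Lemma Ccantor_scaleDr : right_distributive Ccantor_scale +%R.
Proof. by move=> a f g; apply: CcantorP => x; exact: mulrDr. Qed.

Lemma Ccantor_scaleDl f : {morph Ccantor_scale^~ f : a b / a + b}.
Proof. by move=> a b; apply: CcantorP => x; exact: mulrDl. Qed.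

HB.instance Definition _ := GRing.Zmodule_isLmodule.Build F (Ccantor R s)
  Ccantor_scaleA Ccantor_scale1 Ccantor_scaleDr Ccantor_scaleDl.

Lemma CcantorDE f g x : (f + g) x = f x + g x.
Proof. by []. Qed.

Lemma CcantorZE (a : F) f x : (a *: f) x = a * f x.
Proof. by []. Qed.

Lemma CcantorBE f g x : (f - g) x = f x - g x.
Proof. by []. Qed.

Definition sup_norm f : F := supremum 0 (range (fun x => `|f x|)).

Lemma Ccantor_has_ubound f : has_ubound (range (fun x => `|f x|)).
Proof.
have /compact_near_coveringP cov := cantor_space_compact.
have /cov : forall x, [set: cantor_space] x ->
    \forall x' \near x & M \near +oo_F, `|f x'| <= M.
  move=> x _.
  have fx : \forall x' \near x, `|f x'| <= `|f x| + 1.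
    have fx1 : `|f x| < `|f x| + 1 by rewrite ltrDl.
    exact: (cvgr_norm_le (f x) (@Ccantor_continuous f x) _ fx1).
  exists ([set x' | `|f x'| <= `|f x| + 1],
                      [set M | `|f x| + 1 <= M]) => /=.
    split; first exact: fx.
    by apply: nbhs_pinfty_ge; rewrite ger0_real// addr_ge0.
  by move=> [x' M] /= [+ +]; exact: le_trans.
move=> H; near +oo_F => M.
exists M => _ [x _ <-]; have : [set: cantor_space] x by [].
move: x; near: M; exact: H.
Unshelve. all: by end_near. Qed.

Lemma sup_normP f : (forall x, `|f x| <= sup_norm f) /\
  (forall M, (forall x, `|f x| <= M) -> sup_norm f <= M).
Proof.
have : supremums (range (fun x => `|f x|)) !=set0.
  apply: scalar_sup.
  - by exists `|f point|, point.
  - by move=> _ [x _ <-].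
  - exact: Ccantor_has_ubound.
move=> [m [ubm lbm]].
have -> : sup_norm f = m.
  rewrite /sup_norm /supremum ifF.
    by apply: xget_unique => // y [uby lby]; apply/eqP;
      rewrite eq_le lbm ?lby.
  apply/negbTE/set0P; by exists `|f point|, point.
split=> [x|M fM]; first by apply: ubm; exists x.
by apply: lbm => _ [x _ <-].
Qed.

Lemma le_sup_norm f x : `|f x| <= sup_norm f.
Proof. by have [+ _] := sup_normP f; apply. Qed.

Lemma sup_norm_le f M : (forall x, `|f x| <= M) -> sup_norm f <= M.
Proof. by have [_] := sup_normP f; apply. Qed.

Lemma sup_normD f g : sup_norm (f + g) <= sup_norm f + sup_norm g.
Proof.
apply: sup_norm_le => x; apply: le_trans (ler_normD _ _) _.
by rewrite lerD ?le_sup_norm.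
Qed.

Lemma sup_normZ (a : F) f : sup_norm (a *: f) = `|a| * sup_norm f.
Proof.
apply/eqP; rewrite eq_le; apply/andP; split.
  by apply: sup_norm_le => x; rewrite normrM ler_wpM2l ?le_sup_norm.
have [->|a0] := eqVneq a 0.
  by rewrite normr0 mul0r (le_trans _ (le_sup_norm _ point)).
rewrite -ler_pdivlMl ?normr_gt0//; apply: sup_norm_le => x.
rewrite ler_pdivlMl ?normr_gt0// -normrM.
exact: (le_sup_norm (a *: f)).
Qed.

Lemma sup_norm0_eq0 f : sup_norm f = 0 -> f = 0.
Proof.
move=> f0; apply: CcantorP => x; apply/eqP.
by rewrite -normr_le0 -f0 le_sup_norm.
Qed.

HB.instance Definition _ := Lmodule_isNormed.Build F (Ccantor R s)
  sup_normD sup_normZ sup_norm0_eq0.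

Lemma Ccantor_complete (G : set_system (Ccantor R s)) :
  ProperFilter G -> cauchy G -> cvg G.
Proof.
move=> GF /cauchyP Gc.
have lim1 x : exists a : F, (fun f : Ccantor R s => f x) @ G --> a.
  apply/cvg_ex; apply: scalar_complete; apply: cauchy_exP => e e0.
  have [f Gf] := Gc _ e0; exists (f x).
  change (G [set g : Ccantor R s | `|f x - g x| < e]).
  suff sub : ball f e `<=` [set g : Ccantor R s | `|f x - g x| < e].
    exact: filterS sub Gf.
  move=> g; rewrite -ball_normE /ball_/=.
  by move=> fg; rewrite -CcantorBE (le_lt_trans (le_sup_norm _ _)).
have [l lP] := choice lim1.
have lG e : 0 < e -> exists2 f : Ccantor R s,
    G (ball f e) & forall x, `|l x - f x| <= e.
  move=> e0; have [f Gf] := Gc _ e0; exists f => // x.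
  apply/ler_addgt0Pr => d d0.
  have /cvgrPdist_le/(_ d d0) Gl := lP x.
  have [g [/= gl]] := filter_ex (filterI Gl Gf).
  rewrite -ball_normE /ball_/= distrC => gf.
  rewrite (le_trans (ler_distD (g x) _ _))// addrC lerD//.
  by rewrite -CcantorBE (le_trans (le_sup_norm _ _))// ltW.
have lc : continuous l.
  move=> x; apply/cvgrPdist_le => e e0.
  have e40 : 0 < e / 2 / 2 by rewrite !divr_gt0.
  have [f _ lf] := lG _ e40.
  have /cvgrPdist_le/(_ _ e40) := @Ccantor_continuous f x.
  apply: filterS => y fxy.
  rewrite (le_trans (ler_distD (f x) _ _))// (splitr e) lerD//.
    by rewrite (le_trans (lf x))// ler_pdivrMr// ler_peMr ?divr_ge0 ?ltW// ltr1n.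
  rewrite (le_trans (ler_distD (f y) _ _))// (splitr (e / 2)) lerD//.
  by rewrite distrC.
apply/cvg_ex; exists (mkCcantor lc); apply/cvgrPdist_le => e e0.
have e20 : 0 < e / 2 by rewrite divr_gt0.
have [f Gf lf] := lG _ e20.
pose L := mkCcantor lc; change (G [set g : Ccantor R s | `|L - g| <= e]).
suff sub : ball f (e / 2) `<=`
    [set g : Ccantor R s | `|L - g| <= e].
  exact: filterS sub Gf.
move=> g; rewrite -ball_normE /ball_/= => fg.
rewrite (le_trans (ler_distD f _ _))// (splitr e) lerD//; last exact: ltW.
by apply: (@sup_norm_le (L - f)) => x; exact: lf.
Qed.

HB.instance Definition _ :=
  Uniform_isComplete.Build (Ccantor R s) Ccantor_complete.

(* The bits 0 and 1 are [false] and [true]. *)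
Definition cantor_glue (fg : Ccantor R s * Ccantor R s)
    (x : cantor_space) : F :=
  if x 0%N is false then fg.1 (cantor_shift x) else fg.2 (cantor_shift x).

Lemma cantor_glue_continuous fg : continuous (cantor_glue fg).
Proof.
move=> x U Ux.
have near0 : \forall y \near x, (y : cantor_space) 0%N = x 0%N.
  exact: (@cantor_coord_continuous 0%N x [set b | b = x 0%N]).
have cs (h : Ccantor R s) : continuous (h \o cantor_shift).
  move=> y; apply: continuous_comp; first exact: cantor_shift_continuous.
  exact: Ccantor_continuous.
move: Ux; rewrite /cantor_glue; case E : (x 0%N) => /cs.
  by apply: filterS2 near0 => y /=; rewrite E => ->.
by apply: filterS2 near0 => y /=; rewrite E => ->.
Qed.

Definition gamma fg : Ccantor R s := mkCcantor (@cantor_glue_continuous fg).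

Lemma gammaE fg x : gamma fg x = cantor_glue fg x.
Proof. by []. Qed.

End SupNorm.

Section Category.
Variable K : numFieldType.

Definition linear_contraction (V W : normedModType K) (f : V -> W) :=
  linear f /\ forall x, `|f x| <= `|x|.

(* The library norm on a product [V * V] is the max norm. *)
Record Ainf_obj := MkAinf_obj {
  Ainf_space :> completeNormedModType K ;
  Ainf_point : Ainf_space ;
  Ainf_delta : Ainf_space * Ainf_space -> Ainf_space ;
  Ainf_point_le1 : `|Ainf_point| <= 1 ;
  Ainf_delta_contraction : linear_contraction Ainf_delta ;
  Ainf_delta_point : Ainf_delta (Ainf_point, Ainf_point) = Ainf_point }.

Arguments Ainf_point X : rename, clear implicits.
Arguments Ainf_delta X x : rename, clear implicits.

Definition is_Ainf_map (X Y : Ainf_obj) (theta : X -> Y) :=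
  [/\ linear_contraction theta,
      theta (Ainf_point X) = Ainf_point Y &
      forall x1 x2,
        theta (Ainf_delta X (x1, x2)) = Ainf_delta Y (theta x1, theta x2)].
Arguments is_Ainf_map X Y theta : clear implicits.

Lemma is_Ainf_map_id (X : Ainf_obj) : is_Ainf_map X X id.
Proof. by split=> //; split. Qed.

Lemma is_Ainf_map_comp (X Y Z : Ainf_obj) (f : X -> Y) (g : Y -> Z) :
  is_Ainf_map X Y f -> is_Ainf_map Y Z g -> is_Ainf_map X Z (g \o f).
Proof.
move=> [[fl fc] fp fd] [[gl gc] gp gd]; split.
- split=> [a x y|x] /=; first by rewrite fl gl.
  exact: le_trans (gc _) (fc _).
- by rewrite /= fp gp.
- by move=> x1 x2 /=; rewrite fd gd.
Qed.

Definition is_initial (X : Ainf_obj) :=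
  forall Y : Ainf_obj, exists! theta : X -> Y, is_Ainf_map X Y theta.

End Category.

Section CantorObject.
Variables (R : realType) (s : scalars).

Lemma Ccantor_cst1_le1 : `|Ccantor_cst 1 : Ccantor R s| <= 1.
Proof. by apply: sup_norm_le => x; rewrite normr1. Qed.

Lemma gamma_contraction : linear_contraction (@gamma R s).
Proof.
split=> [a f g|f].
  apply: CcantorP => x.
  rewrite CcantorDE CcantorZE !gammaE /cantor_glue.
  by case: (x 0%N); rewrite CcantorDE CcantorZE.
rewrite prod_normE; apply: sup_norm_le => x.
rewrite gammaE /cantor_glue comparable_le_max ?real_comparable ?normr_real//.
by case: (x 0%N); rewrite (le_sup_norm _ (cantor_shift x)) ?orbT.
Qed.

Lemma gamma_cst1 : gamma (Ccantor_cst 1, Ccantor_cst 1) = Ccantor_cst 1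
  :> Ccantor R s.
Proof. by apply: CcantorP => x; rewrite gammaE /cantor_glue; case: (x 0%N). Qed.

Definition Ccantor_obj : Ainf_obj (scalar_field R s) :=
  MkAinf_obj Ccantor_cst1_le1 gamma_contraction gamma_cst1.

End CantorObject.

(* Main.v *)
(** A function of small oscillation on the cylinders of length [n] is determined
    up to a small error by its restrictions to the [2^n] cylinders, on which it
    is nearly constant. Unfolding [f = gamma (f_0, f_1)] [n] times therefore
    forces the value at [f] of a map into [(V, v, delta)] up to that error: it is
    close to the [n]-fold iterate of [delta] applied to multiples of [v]. By
    compactness every continuous function on Cantor space has small oscillation
    on long cylinders, so the iterates form a Cauchy sequence whose limit is the
    unique map. *)
Require Import Defs.
From mathcomp Require Import all_boot all_order all_algebra.
From mathcomp Require Import all_classical all_reals topology normedtype sequences cantor.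

Set Implicit Arguments.
Unset Strict Implicit.
Unset Printing Implicit Defensive.

Import Order.TTheory GRing.Theory Num.Theory.
Import numFieldNormedType.Exports.

Local Open Scope classical_set_scope.
Local Open Scope ring_scope.

(** * Cylinders and the topology of Cantor space *)

Definition eq_upto (n : nat) (x y : cantor_space) :=
  forall i, (i < n)%N -> x i = y i.

Definition cantor_cons (b : bool) (x : cantor_space) : cantor_space :=
  fun n => if n is m.+1 then x m else b.

Lemma cantor_cons_shift x : cantor_cons (x 0%N) (cantor_shift x) = x.
Proof. by apply: funext => -[]. Qed.

Lemma eq_upto_cons b n x y :
  eq_upto n x y -> eq_upto n.+1 (cantor_cons b x) (cantor_cons b y).
Proof. by move=> xy [|i] //=; rewrite ltnS; exact: xy. Qed.

(** The topology is the product one and bits are discrete, so only eventual equality in each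
    coordinate is at stake. *)
Lemma cvg_cantor {T : Type} (G : set_system T) (h : T -> cantor_space)
    (x : cantor_space) : Filter G ->
  (forall i, \forall t \near G, h t i = x i) -> h @ G --> x.
Proof.
move=> GF hx; apply/cvg_sup => n U [V [[W oW] <-] Wx VU].
apply: (filterS VU); apply: filterS (hx n) => t /= htx.
by rewrite /preimage/= htx.
Qed.

Lemma cantor_cons_continuous b : continuous (cantor_cons b).
Proof.
move=> x; apply: cvg_cantor => -[|i] /=; first exact: nearW.
exact: (@cantor_coord_continuous i x [set c | c = x i]).
Qed.

Lemma near_eq_upto n (x : cantor_space) :
  nbhs x [set y : cantor_space | eq_upto n x y].
Proof.
pose f (i : 'I_n) := [set y : cantor_space | y i = x i].
apply: filterS (filter_forall (f := f) _ _) => [y xy i ltin|i].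
  by have /= -> := xy (Ordinal ltin).
exact: (@cantor_coord_continuous i x [set c | c = x i]).
Qed.

(** Otherwise each [n] yields a point outside [U] sharing [n] bits with [x], and these points
    converge to [x]. *)
Lemma nbhs_cantor (x : cantor_space) (U : set cantor_space) :
  nbhs x U -> exists n, forall y, eq_upto n x y -> U y.
Proof.
move=> Ux; apply: contrapT => /forallNP noN.
have /choice[y yP] n : exists y, eq_upto n x y /\ ~ U y.
  by have /existsNP[y /not_implyP] := noN n; exists y.
have yx : y @ \oo --> x.
  apply: cvg_cantor => i; exists i.+1 => // n /= ltin.
  by have [-> //] := yP n.
have /filter_ex[n Uyn] : \forall n \near \oo, U (y n) by exact: yx.
by have [_] := yP n.
Qed.

(** * Restriction to the two halves and oscillation on cylinders *)

Section Oscillation.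
Variables (R : realType) (s : scalars).
Local Notation F := (scalar_field R s).
Local Notation C := (Ccantor R s).
Implicit Types (f g : C) (e : F).

Lemma Ccantor_cons_continuous b f : continuous (f \o cantor_cons b).
Proof.
move=> x; apply: continuous_comp; first exact: cantor_cons_continuous.
exact: Ccantor_continuous.
Qed.

Definition restr b f : C := mkCcantor (@Ccantor_cons_continuous b f).

Lemma restr_linear b a f g : restr b (a *: f + g) = a *: restr b f + restr b g.
Proof. exact: CcantorP. Qed.

Lemma gamma_restr f : gamma (restr false f, restr true f) = f.
Proof.
apply: CcantorP => x; rewrite gammaE /cantor_glue -[in RHS](cantor_cons_shift x).
by case: (x 0%N).
Qed.

Lemma restr_gamma b f g : restr b (gamma (f, g)) = if b then g else f.
Proof. by apply: CcantorP => x; case: b. Qed.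

Lemma restr_cst b (a : F) : restr b (Ccantor_cst a : C) = Ccantor_cst a.
Proof. exact: CcantorP. Qed.

Lemma restr_norm b f : `|restr b f| <= `|f|.
Proof. by apply: sup_norm_le => x; exact: (le_sup_norm f). Qed.

Definition osc_le n f e := forall x y, eq_upto n x y -> `|f x - f y| <= e.

Lemma osc_le_restr b n f e : osc_le n.+1 f e -> osc_le n (restr b f) e.
Proof. by move=> fe x y /(eq_upto_cons b) /fe. Qed.

(** Continuity gives a suitable length near each point; compactness makes it uniform. *)
Lemma osc_small f e : 0 < e -> exists n, osc_le n f e.
Proof.
move=> e0; have e20 : 0 < e / 2 by rewrite divr_gt0.
have /compact_near_coveringP cov := cantor_space_compact.
have : \forall n \near \oo, [set: cantor_space] `<=`
    [set x | forall y, eq_upto n x y -> `|f x - f y| <= e].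
  apply: cov => x _.
  have /cvgrPdist_le/(_ _ e20)/nbhs_cantor[n nP] := @Ccantor_continuous _ _ f x.
  (* For [x'] in the cylinder of length [n] around [x] and [n <= m], both [x'] and [y] lie in that
     cylinder, so both values are within [e / 2] of [f x]. *)
  exists ([set x' | eq_upto n x x'], [set m | (n <= m)%N]) => /=.
    by split; [exact: near_eq_upto|exists n].
  move=> [x' m] /= [xx' nm] y x'y.
  rewrite (le_trans (ler_distD (f x) _ _))// (splitr e) lerD//.
    by rewrite distrC; exact: nP.
  by apply: nP => i ltin; rewrite xx'// x'y// (leq_trans ltin).
by move=> [n _ /(_ n (leqnn n)) nP]; exists n => x y; exact: nP.
Qed.

End Oscillation.

(** * Linear contractions and the max norm on pairs *)

Section LinearContraction.
Variable K : numFieldType.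

Lemma lcontraction_sub (V W : normedModType K) (f : V -> W) (x y : V) :
  linear_contraction f -> f (x - y) = f x - f y.
Proof.
by move=> [fl _]; rewrite -[x - y]addrC -scaleN1r fl scaleN1r addrC.
Qed.

Lemma lcontraction_dist (V W : normedModType K) (f : V -> W) (x y : V) :
  linear_contraction f -> `|f x - f y| <= `|x - y|.
Proof. by move=> fc; rewrite -lcontraction_sub//; case: fc => _; apply. Qed.

Lemma lcontraction_continuous (V W : normedModType K) (f : V -> W) :
  linear_contraction f -> continuous f.
Proof.
move=> fc x; apply/cvgrPdist_le => e e0.
have : (id @ x --> x) by exact: cvg_id.
move/cvgrPdist_le => /(_ e e0); apply: filterS => y.
exact: le_trans (lcontraction_dist _ _ fc).
Qed.

Lemma norm_pair_le (V W : normedModType K) (x : V) (y : W) (e : K) :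
  (`|(x, y)| <= e) = (`|x| <= e) && (`|y| <= e).
Proof.
by rewrite prod_normE comparable_ge_max ?real_comparable ?normr_real.
Qed.

End LinearContraction.

(** * Towers of maps into a fixed object and the limit map *)

Section Towers.
Variables (R : realType) (s : scalars).
Local Notation F := (scalar_field R s).
Local Notation C := (Ccantor R s).
Variable Y : Ainf_obj F.
Local Notation v := (@Ainf_point _ Y).
Local Notation delta := (@Ainf_delta _ Y).

(* A map into [Y] is a constant tower; its finite approximations also form a
   tower, and so do all shifts of it. *)
Record tower (phi : nat -> C -> Y) : Prop := Tower {
  tower_contraction : forall n, linear_contraction (phi n) ;
  tower_cst1 : forall n, phi n (Ccantor_cst 1) = v ;
  tower_gamma : forall n f g,
    phi n.+1 (gamma (f, g)) = delta (phi n f, phi n g) }.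

(** At level 0, both towers agree on constants and [f] is within [e] of one, which costs [e] per
    tower. Going up a level costs nothing, as [delta] contracts the max norm. *)
Lemma tower_dist phi psi : tower phi -> tower psi ->
  forall n f e, osc_le n f e -> `|phi n f - psi n f| <= e *+ 2.
Proof.
move=> phiT psiT; elim=> [|n IHn] f e fe.
  pose c : C := Ccantor_cst (f point); pose h := f - c.
  have he : `|h| <= e by apply: sup_norm_le => x; exact: fe.
  (* The [+ 0] gives [c] the shape to which [linear] applies. *)
  have cE : c = f point *: Ccantor_cst 1 + 0.
    by rewrite addr0; apply: CcantorP => x; rewrite CcantorZE /= mulr1.
  have towerc chi : tower chi -> chi 0%N c = f point *: v.
    move=> chiT; have [lin _] := tower_contraction chiT 0%N.
    have chi0 : chi 0%N 0 = 0.
      by rewrite -(subrr 0) (lcontraction_sub _ _ (tower_contraction chiT _)) subrr.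
    by rewrite cE lin (tower_cst1 chiT) chi0 addr0.
  have dist chi : tower chi -> `|chi 0%N f - f point *: v| <= e.
    move=> chiT; rewrite -(towerc _ chiT).
    exact: le_trans (lcontraction_dist _ _ (tower_contraction chiT _)) he.
  rewrite (le_trans (ler_distD (f point *: v) _ _))// mulr2n lerD ?dist//.
  by rewrite distrC dist.
rewrite -(gamma_restr f) !tower_gamma//.
apply: le_trans (lcontraction_dist _ _ (Ainf_delta_contraction Y)) _.
by rewrite norm_pair_le !IHn//; exact: osc_le_restr.
Qed.

Lemma tower_map (theta : Ccantor_obj R s -> Y) :
  is_Ainf_map theta -> tower (fun _ => theta).
Proof. by move=> [tc tp td]; split. Qed.

(** This lets approximations of different depths be compared at one level by [tower_dist]. *)
Lemma tower_shift k phi : tower phi -> tower (fun n => phi (k + n)%N).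
Proof.
by move=> [pc pp pd]; split=> // n f g; rewrite addnS pd.
Qed.

(** Each cylinder of length [n] contributes one sample of [f], taken at its word followed by
    [point]. *)
Fixpoint approx n (f : C) : Y :=
  if n is m.+1 then delta (approx m (restr false f), approx m (restr true f))
  else f point *: v.

Lemma approx_contraction n : linear_contraction (approx n).
Proof.
have [dl dc] := Ainf_delta_contraction Y.
elim: n => [|n [IHl IHc]]; split=> [a f g|f] /=.
- by rewrite CcantorDE CcantorZE scalerDl scalerA.
- rewrite normrZ -[leRHS]mulr1; apply: ler_pM => //; last exact: Ainf_point_le1.
  exact: le_sup_norm.
- by rewrite !restr_linear !IHl -dl.
- apply: le_trans (dc _) _.
  by rewrite norm_pair_le !(le_trans (IHc _))// restr_norm.
Qed.

Lemma approx_tower : tower approx.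
Proof.
split=> [|n|n f g]; first exact: approx_contraction.
  by elim: n => [|n IHn] /=; rewrite ?scale1r// !restr_cst IHn Ainf_delta_point.
by rewrite /= !restr_gamma.
Qed.

Lemma approx_cvg f : cvg (approx n f @[n --> \oo]).
Proof.
apply: cauchy_cvg; apply: cauchy_exP => e e0.
(* [tower_dist] doubles [e / 4] to [e / 2], strictly below the radius [e] of the open ball. *)
have [n fn] : exists n, osc_le n f (e / 2 / 2).
  by apply: osc_small; rewrite !divr_gt0.
exists (approx n f); exists n => // m /= /subnK <-.
rewrite /= -ball_normE /ball_/=.
have := tower_dist approx_tower (tower_shift (m - n) approx_tower) fn.
move=> /le_lt_trans; apply.
by rewrite mulr2n -splitr// ltr_pdivrMr// ltr_pMr// ltr1n.
Qed.

Definition Ainf_lim f : Y := lim (approx n f @[n --> \oo]).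

Lemma Ainf_lim_map : is_Ainf_map (Ainf_lim : Ccantor_obj R s -> Y).
Proof.
split.
- split=> [a f g|f].
    apply: cvg_lim => //.
    under eq_fun do rewrite (approx_contraction _).1.
    by apply: cvgD; [apply: cvgZr|]; exact: approx_cvg.
  apply/ler_addgt0Pr => e e0.
  have /cvgrPdist_le/(_ e e0)/filter_ex[n fn] := approx_cvg (f := f).
  rewrite addrC -[Ainf_lim f](subrK (approx n f)).
  apply: le_trans (ler_normD _ _) _.
  by rewrite lerD// (approx_contraction n).2.
- apply: cvg_lim => //=; under eq_fun do rewrite (tower_cst1 approx_tower).
  exact: cvg_cst.
(* Dropping the first term leaves only successor levels, where [tower_gamma] applies; continuity of
   [delta] then gives the limit. *)
- move=> f g; apply: cvg_lim => //=; rewrite -cvg_shiftS.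
  under eq_fun do rewrite (tower_gamma approx_tower).
  apply: continuous_cvg.
    exact: lcontraction_continuous (Ainf_delta_contraction Y) _.
  by apply: cvg_pair; exact: approx_cvg.
Qed.

End Towers.

Theorem proposition2p6 (R : realType) (s : scalars) :
  is_initial (Ccantor_obj R s).
Proof.
move=> Y; exists (@Ainf_lim R s Y); split; first exact: Ainf_lim_map.
move=> theta thetaM; apply: funext => f; apply/eqP.
rewrite -subr_eq0 -normr_le0; apply/ler_addgt0Pr => e e0; rewrite add0r.
have [n fn] : exists n, osc_le n f (e / 2).
  by apply: osc_small; rewrite divr_gt0.
(* Both maps are constant towers, so their values at [f] differ by at most twice [e / 2], with [e]
   arbitrary. *)
have := tower_dist (tower_map (Ainf_lim_map Y)) (tower_map thetaM) fn.
by rewrite mulr2n -splitr.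
Qed.
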